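(* Let $\Gamma$ be a restricted-normal digraph of order $n$ with adjacency matrix $A$. For $k\ge1$, the digraph $\hat\Gamma$ with adjacency matrix $A\otimes J_k$ is a restricted-normal digraph of order $nk$. Furthermore, $\hat\Gamma$ is a directed join if and only if $\Gamma$ is a directed join.
   Context: Digraphs are finite, simple (no loops) and unweighted. $J_k$ is the $k\times k$ all-ones matrix and $\otimes$ is the Kronecker product. The Laplacian of a digraph is $L=D-A$ with $D$ the diagonal matrix of out-degrees. $\mathbf{e}$ is the all-ones vector; a restrictor matrix of order $N$ is an $N\times(N-1)$ matrix $Q$ with orthonormal columns orthogonal to $\mathbf{e}$. A digraph is restricted-normal if $L$ is not normal but $Q^*LQ$ is normal (independent of the choice of $Q$). A digraph $(V,E)$ is a directed join if there is a partition $V=V_1\sqcup V_2$ into nonempty sets such that $(i,j)\in E$ for all $i\in V_1,j\in V_2$ and there is no edge $(j,i)\in E$ with $j\in V_2,i\in V_1$. *)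

(* Defs.v *)
From HB Require Import structures.
From mathcomp Require Import all_boot all_order all_algebra.
From mathcomp Require Import mxtens.

Set Implicit Arguments.
Unset Strict Implicit.
Unset Printing Implicit Defensive.

Import Order.TTheory GRing.Theory Num.Theory.
Local Open Scope ring_scope.
Local Open Scope sesquilinear_scope.

Record digraph (n : nat) := Digraph {
  edge :> rel 'I_n;
  edge_irr : irreflexive edge
}.

Definition outdeg n (G : digraph n) (i : 'I_n) : nat := #|[set j | G i j]|.

Definition adjmx (C : pzRingType) n (G : digraph n) : 'M[C]_n :=
  \matrix_(i, j) (G i j)%:R.

Definition laplacian (C : pzRingType) n (G : digraph n) : 'M[C]_n :=
  diag_mx (\row_i (outdeg G i)%:R) - adjmx C G.

Definition ones (C : pzRingType) k : 'M[C]_k := const_mx 1.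

(* The columns of Q are orthonormal, and orthogonal to the all-ones vector. *)
Definition restrictor (C : numClosedFieldType) N (Q : 'M[C]_(N, N.-1)) : Prop :=
  Q^t* *m Q = 1%:M /\ (const_mx 1 : 'cV[C]_N)^t* *m Q = 0.

(* [restricted_normal_indep] below: any other restrictor matrix gives the same
   notion. *)
Definition restricted_normal (C : numClosedFieldType) n (G : digraph n) : Prop :=
  laplacian C G \isn't normalmx /\
  exists2 Q : 'M[C]_(n, n.-1),
    restrictor Q & Q^t* *m laplacian C G *m Q \is normalmx.

Definition directed_join n (G : digraph n) : Prop :=
  exists V1 V2 : {set 'I_n},
    [/\ V1 :|: V2 = setT, [disjoint V1 & V2], V1 != set0, V2 != set0 &
      forall i j, i \in V1 -> j \in V2 -> G i j /\ ~~ G j i].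

Lemma trmxC_mul (C : numClosedFieldType) m n p (A : 'M[C]_(m, n))
    (B : 'M[C]_(n, p)) : (A *m B)^t* = B^t* *m A^t*.
Proof. by rewrite trmx_mul map_mxM. Qed.

(* So "the digraph with adjacency matrix M" is well defined. *)
Lemma adjmx_inj (C : numClosedFieldType) n (G H : digraph n) :
  adjmx C G = adjmx C H -> G =2 H.
Proof.
move=> eqGH i j; move/matrixP/(_ i j)/eqP: eqGH.
by rewrite !mxE eqr_nat; case: (G i j) (H i j) => [] [].
Qed.

Lemma restrictor_sub (C : numClosedFieldType) N (P Q : 'M[C]_(N, N.-1)) :
  restrictor P -> restrictor Q -> (Q^t* <= P^t*)%MS.
Proof.
move=> rP rQ.
pose e : 'cV[C]_N := const_mx 1.
have ker (R : 'M[C]_(N, N.-1)) : restrictor R -> (R^t* <= kermx e)%MS.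
  case=> _ R0; apply/sub_kermxP.
  by rewrite -[e]trmxCK -trmxC_mul R0 trmx0 map_mx0.
have rk (R : 'M[C]_(N, N.-1)) : restrictor R -> \rank (R^t*) = N.-1.
  case=> R1 _; apply: mxrank_unitary; apply/unitarymxP.
  by rewrite trmxCK.
have rke : (\rank (kermx e) <= N.-1)%N.
  rewrite mxrank_ker; have [N0|N0] := posnP N.
    by rewrite leq_subLR; apply: leq_trans (leq_addl _ _); rewrite N0.
  rewrite -[X in (_ <= X)%N]subn1 leq_sub2l // lt0n mxrank_eq0.
  by apply/eqP => /matrixP/(_ (Ordinal N0) 0)/eqP; rewrite !mxE oner_eq0.
apply: submx_trans (ker _ rQ) _.
by rewrite -(geq_leqif (mxrank_leqif_sup (ker _ rP))) rk.
Qed.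

Lemma restrictor_normal_indep (C : numClosedFieldType) N (M : 'M[C]_N)
    (P Q : 'M[C]_(N, N.-1)) :
  restrictor P -> restrictor Q ->
  P^t* *m M *m P \is normalmx -> Q^t* *m M *m Q \is normalmx.
Proof.
move=> rP rQ /normalmxP nP.
have /submxP[U QU] := restrictor_sub rP rQ.
have QE : Q = P *m U^t* by rewrite -[Q]trmxCK QU trmxC_mul trmxCK.
have UU : U *m U^t* = 1%:M.
  case: rQ => <- _; rewrite QU QE mulmxA -[_ *m P]mulmxA.
  by case: rP => -> _; rewrite mulmx1.
have U'U : U^t* *m U = 1%:M by apply: mulmx1C.
have E : Q^t* *m M *m Q = U *m (P^t* *m M *m P) *m U^t*.
  by rewrite QU QE !mulmxA.
apply/normalmxP; rewrite E; move: (P^t* *m M *m P) nP => X nX.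
rewrite !trmxC_mul !trmxCK !mulmxA.
rewrite -[_ *m U^t* *m U]mulmxA U'U mulmx1 -[_ *m U^t* *m U]mulmxA U'U mulmx1.
by rewrite -[U *m X *m _]mulmxA nX !mulmxA.
Qed.

Lemma restricted_normal_indep (C : numClosedFieldType) n (G : digraph n)
    (Q : 'M[C]_(n, n.-1)) : restrictor Q ->
  restricted_normal C G <->
  laplacian C G \isn't normalmx /\ Q^t* *m laplacian C G *m Q \is normalmx.
Proof.
move=> rQ; split=> [[nL [P rP nP]]|[nL nQ]]; split=> //; last by exists Q.
exact: restrictor_normal_indep rP rQ nP.
Qed.

(* Main.v *)
(** Let P = I - J/N be the orthogonal projection onto the complement of e.
    Since L e = 0, Q^* L Q is normal if and only if P L is: conjugation by the
    isometry Q turns the former into P L P = P L. The Laplacian of the blow-up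
    is L (x) J + D (x) (k I - J), with D the degree matrix, and multiplying it by
    the projection P of order nk gives PL (x) J + D (x) (k I - J). As J and
    k I - J are k times complementary orthogonal projections and D is normal,
    A (x) J + D (x) (k I - J) is normal if and only if A is; take A = L and
    A = P L. *)
Require Import Defs.
From mathcomp Require Import all_boot all_order all_algebra mxtens.
Local Open Scope ring_scope.

Set Implicit Arguments.
Unset Strict Implicit.
Unset Printing Implicit Defensive.

Import Order.TTheory GRing.Theory Num.Theory.
Local Open Scope sesquilinear_scope.

(** * Bilinearity of the Kronecker product *)

Section Tensor.

Variables (R : comPzRingType) (m n p q : nat).
Implicit Types (A B : 'M[R]_(m, n)) (E F : 'M[R]_(p, q)).

Lemma tensmxDl A B E : tensmx (A + B) E = tensmx A E + tensmx B E.
Proof. by apply/matrixP=> i j; rewrite !mxE mulrDl. Qed.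

Lemma tensmxBl A B E : tensmx (A - B) E = tensmx A E - tensmx B E.
Proof. by apply/matrixP=> i j; rewrite !mxE mulrBl. Qed.

Lemma tensmxBr A E F : tensmx A (E - F) = tensmx A E - tensmx A F.
Proof. by apply/matrixP=> i j; rewrite !mxE mulrBr. Qed.

Lemma tensmxZl a A E : tensmx (a *: A) E = a *: tensmx A E.
Proof. by apply/matrixP=> i j; rewrite !mxE mulrA. Qed.

Lemma tensmxZr a A E : tensmx A (a *: E) = a *: tensmx A E.
Proof. by apply/matrixP=> i j; rewrite !mxE mulrCA. Qed.

Lemma tensmx_const (a b : R) :
  tensmx (const_mx a : 'M_(m, n)) (const_mx b : 'M_(p, q)) = const_mx (a * b).
Proof. by apply/matrixP=> i j; rewrite !mxE. Qed.

End Tensor.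

Lemma trmxC_tens (C : numClosedFieldType) m n p q
    (A : 'M[C]_(m, n)) (B : 'M[C]_(p, q)) :
  (tensmx A B)^t* = tensmx (A^t*) (B^t*).
Proof. by rewrite trmx_tens map_mxT. Qed.

Lemma const_mx1_mul (R : pzRingType) m n p :
  (const_mx 1 : 'M[R]_(m, n)) *m (const_mx 1 : 'M_(n, p)) = const_mx n%:R.
Proof.
apply/matrixP=> i j; rewrite !mxE (eq_bigr (fun=> 1)) => [|s _].
  by rewrite sumr_const card_ord.
by rewrite !mxE mulr1.
Qed.

(** * Algebra of blown-up matrices *)

Definition centering (C : numClosedFieldType) N : 'M[C]_N :=
  1%:M - N%:R^-1 *: ones C N.

Definition cones (C : numClosedFieldType) k : 'M[C]_k :=
  k%:R *: 1%:M - ones C k.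

(** [A] acts on the vectors constant on each group of [k] copies, [B] on their orthogonal
    complement. Both projections stay multiplied by [k], which avoids division. *)
Definition blowup (C : numClosedFieldType) k n (A B : 'M[C]_n) : 'M[C]_(n * k) :=
  tensmx A (ones C k) + tensmx B (cones C k).

Section Blowup.

Variables (C : numClosedFieldType) (k : nat).

Lemma ones_mul : ones C k *m ones C k = k%:R *: ones C k.
Proof.
rewrite const_mx1_mul; apply/matrixP=> i j.
by rewrite !mxE mulr1.
Qed.

Lemma ones_cones : ones C k *m cones C k = 0.
Proof. by rewrite mulmxBr ones_mul -scalemxAr mulmx1 subrr. Qed.

Lemma cones_ones : cones C k *m ones C k = 0.
Proof. by rewrite mulmxBl ones_mul -scalemxAl mul1mx subrr. Qed.

Lemma cones_mul : cones C k *m cones C k = k%:R *: cones C k.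
Proof.
by rewrite {1}/cones mulmxBl ones_cones subr0 -scalemxAl mul1mx.
Qed.

Lemma trmxC_ones : (ones C k)^t* = ones C k.
Proof. by apply/matrixP=> i j; rewrite !mxE rmorph1. Qed.

Lemma trmxC_cones : (cones C k)^t* = cones C k.
Proof.
apply/matrixP=> i j.
by rewrite !mxE rmorphB rmorphM !rmorph_nat rmorph1 eq_sym.
Qed.

Lemma trmxC_blowup n (A B : 'M[C]_n) :
  (blowup k A B)^t* = blowup k (A^t*) (B^t*).
Proof.
by rewrite linearD map_mxD !trmxC_tens trmxC_ones trmxC_cones.
Qed.

(* [ones] and [cones] are, up to the factor k, complementary projections. *)
Lemma blowup_mul n (A A' B B' : 'M[C]_n) :
  blowup k A B *m blowup k A' B' = k%:R *: blowup k (A *m A') (B *m B').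
Proof.
rewrite /blowup mulmxDl !mulmxDr !tensmx_mul ones_mul cones_mul.
by rewrite ones_cones cones_ones !tensmx0 addr0 add0r !tensmxZr scalerDr.
Qed.

(** Once the common [cones] term cancels, the entries at copy [z] of each vertex give back [A] and
    [A']; such a copy exists because [k] is positive. *)
Lemma blowup_injl n (A A' B : 'M[C]_n) :
  (0 < k)%N -> blowup k A B = blowup k A' B -> A = A'.
Proof.
move=> k_gt0 /addIr/matrixP eqAA'; apply/matrixP=> i j.
pose z := Ordinal k_gt0.
move/(_ (mxtens_index (i, z)) (mxtens_index (j, z))): eqAA'.
by rewrite !tensmxE mxE !mulr1.
Qed.

(** By [blowup_mul], both products with the adjoint are [k] times blow-ups, whose second components
    agree because [B] is normal; only the first ones remain to be compared. *)
Lemma blowup_normal n (A B : 'M[C]_n) : (0 < k)%N -> B \is normalmx ->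
  (blowup k A B \is normalmx) = (A \is normalmx).
Proof.
move=> k_gt0 /normalmxP nB.
have k_neq0 : k%:R != 0 :> C by rewrite pnatr_eq0 -lt0n.
apply/normalmxP/normalmxP; rewrite trmxC_blowup !blowup_mul nB.
  by move/(scalerI k_neq0)/(blowup_injl k_gt0).
by move->.
Qed.

(** The all-ones matrix of order [n * k] is a tensor product of all-ones matrices. It kills the
    [cones] term, and on the other term the factor [k] from [ones_mul] turns the inverse of [n * k]
    into that of [n]. *)
Lemma centering_blowup n (A B : 'M[C]_n) : (0 < k)%N ->
  centering C (n * k) *m blowup k A B = blowup k (centering C n *m A) B.
Proof.
move=> k_gt0; have k_neq0 : k%:R != 0 :> C by rewrite pnatr_eq0 -lt0n.
have onesE : ones C (n * k) = tensmx (ones C n) (ones C k).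
  by rewrite tensmx_const mulr1.
rewrite /centering onesE !mulmxBl !mul1mx -!scalemxAl {2}/blowup mulmxDr !tensmx_mul ones_mul.
rewrite ones_cones tensmx0 addr0 tensmxZr scalerA natrM invfM mulrVK ?unitfE //.
by rewrite /blowup tensmxBl tensmxZl addrAC.
Qed.

End Blowup.

(** * Restrictor matrices and the centering projection *)

Section Restrictor.

Variable C : numClosedFieldType.

(** Conjugation by an isometry is injective and respects products and adjoints. *)
Lemma isometry_conj_normal m n (Q : 'M[C]_(m, n)) (B : 'M[C]_n) :
  Q^t* *m Q = 1%:M -> (Q *m B *m Q^t* \is normalmx) = (B \is normalmx).
Proof.
move=> Q1.
have mulE (X Y : 'M[C]_n) :
    Q *m X *m Q^t* *m (Q *m Y *m Q^t*) = Q *m (X *m Y) *m Q^t*.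
  by rewrite !mulmxA -[_ *m Q^t* *m Q]mulmxA Q1 mulmx1.
have injQ (X Y : 'M[C]_n) : Q *m X *m Q^t* = Q *m Y *m Q^t* -> X = Y.
  move/(congr1 (fun Z => Q^t* *m Z *m Q)); rewrite !mulmxA !Q1 !mul1mx.
  by rewrite -!mulmxA !Q1 !mulmx1.
apply/normalmxP/normalmxP; rewrite !trmxC_mul trmxCK [Q *m (_ *m _)]mulmxA !mulE.
  exact: injQ.
by move->.
Qed.

(** The square matrix with blocks [e] and [Q] has a left inverse, with blocks [e^t*] divided by the
    order and [Q^t*]. It is also a right inverse, which expands the identity as the sum of the two
    projections. *)
Lemma restrictor_proj N (Q : 'M[C]_(N, N.-1)) : (0 < N)%N ->
  restrictor Q -> Q *m Q^t* = centering C N.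
Proof.
case: N Q => // N Q _ [Q1 Q0].
pose e : 'cV[C]_N.+1 := const_mx 1.
have et : e^t* = const_mx 1 by apply/matrixP=> i j; rewrite !mxE rmorph1.
have Qe : Q^t* *m e = 0 by rewrite -[e]trmxCK -trmxC_mul Q0 trmx0 map_mx0.
have e1 : N.+1%:R^-1 *: e^t* *m e = 1%:M.
  rewrite et -scalemxAl const_mx1_mul; apply/matrixP=> i j.
  by rewrite !ord1 !mxE mulVf // pnatr_eq0.
have : col_mx (N.+1%:R^-1 *: e^t*) (Q^t*) *m row_mx e Q = 1%:M :> 'M_(1 + N).
  rewrite mul_col_row e1 -scalemxAl Q0 scaler0 Qe Q1.
  by rewrite -scalar_mx_block.
move/mulmx1C; rewrite mul_row_col -scalemxAr et const_mx1_mul.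
by move=> sum1; apply/eqP; rewrite /centering eq_sym subr_eq addrC -sum1.
Qed.

(** Gram-Schmidt applied to a row basis of the kernel of [e], followed by the adjoint. *)
Lemma restrictor_exists N : (0 < N)%N -> exists Q : 'M[C]_(N, N.-1), restrictor Q.
Proof.
move=> N_gt0; pose e : 'cV[C]_N := const_mx 1.
have rk_e : \rank e = 1%N.
  apply/eqP; rewrite eqn_leq rank_leq_col lt0n mxrank_eq0.
  by apply/eqP=> /matrixP/(_ (Ordinal N_gt0) 0)/eqP; rewrite !mxE oner_eq0.
have rk : \rank (kermx e) = N.-1 by rewrite mxrank_ker rk_e subn1.
pose B := castmx (rk, erefl N) (row_base (kermx e)).
have BE : (B :=: kermx e)%MS.
  exact: eqmx_trans (eqmx_cast _ _) (eq_row_base _).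
have freeB : row_free B by rewrite /row_free BE rk.
have /unitarymxP S1 : schmidt B \is unitarymx.
  by rewrite schmidt_unitarymx // leq_pred.
exists ((schmidt B)^t*); split; rewrite ?trmxCK // -trmxC_mul.
suff -> : schmidt B *m e = 0 by rewrite trmx0 map_mx0.
by apply/sub_kermxP; rewrite eqmx_schmidt_free // BE.
Qed.

Lemma restriction_normal N (M : 'M[C]_N) (Q : 'M[C]_(N, N.-1)) :
  (0 < N)%N -> restrictor Q -> M *m ones C N = 0 ->
  (Q^t* *m M *m Q \is normalmx) = (centering C N *m M \is normalmx).
Proof.
move=> N_gt0 rQ M0; rewrite -(isometry_conj_normal _ rQ.1); congr (_ \is _).
rewrite !mulmxA (restrictor_proj N_gt0 rQ) -mulmxA (restrictor_proj N_gt0 rQ).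
by rewrite -mulmxA mulmxBr mulmx1 -scalemxAr M0 scaler0 subr0.
Qed.

End Restrictor.

(** * Laplacians and a criterion without restrictors *)

Section Laplacian.

Variable C : numClosedFieldType.

Definition degmx n (G : digraph n) : 'M[C]_n :=
  diag_mx (\row_i (outdeg G i)%:R).

Lemma outdeg_sum n (G : digraph n) i : outdeg G i = (\sum_j G i j)%N.
Proof.
rewrite /outdeg -sum1_card big_mkcond /=; apply: eq_bigr => j _.
by rewrite inE; case: (G i j).
Qed.

Lemma laplacian_ones n (G : digraph n) : laplacian C G *m ones C n = 0.
Proof.
apply/matrixP=> i j; rewrite mulmxBl mul_diag_mx !mxE outdeg_sum natr_sum mulr1.
by apply/eqP; rewrite subr_eq0; apply/eqP/eq_bigr => s _; rewrite !mxE mulr1.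
Qed.

Lemma degmx_normal n (G : digraph n) : degmx G \is normalmx.
Proof.
apply/normalmxP; rewrite tr_diag_mx map_diag_mx /degmx !mulmx_diag.
by congr diag_mx; apply/rowP=> i; rewrite !mxE mulrC.
Qed.

(** With [Q] eliminated, digraphs of orders [n] and [n * k] can be compared without relating their
    restrictors. *)
Lemma restricted_normal_centering n (G : digraph n) : (0 < n)%N ->
  restricted_normal C G <->
  laplacian C G \isn't normalmx /\
  centering C n *m laplacian C G \is normalmx.
Proof.
move=> n_gt0; have [Q rQ] := restrictor_exists C n_gt0.
have := restricted_normal_indep G rQ.
by rewrite restriction_normal ?laplacian_ones.
Qed.

End Laplacian.

(** * The blown-up digraph *)

Section BlowupDigraph.

Variables (n k : nat) (G : digraph n).

(** An index encodes a pair of a vertex of [G] and a copy number, which adjacency ignores. *)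
Definition blowup_edge : rel 'I_(n * k) :=
  fun i j => G (mxtens_unindex i).1 (mxtens_unindex j).1.

Lemma blowup_edge_irr : irreflexive blowup_edge.
Proof. by move=> i; apply: edge_irr. Qed.

Definition blowup_digraph : digraph (n * k) := Digraph blowup_edge_irr.

Lemma adjmx_blowup (C : pzRingType) :
  adjmx C blowup_digraph = tensmx (adjmx C G) (ones C k).
Proof. by apply/matrixP=> i j; rewrite !mxE mulr1. Qed.

Lemma outdeg_blowup i :
  outdeg blowup_digraph i = (outdeg G (mxtens_unindex i).1 * k)%N.
Proof.
rewrite !outdeg_sum big_distrl /=.
rewrite (reindex (@mxtens_index n k)) /=; last first.
  by exists (@mxtens_unindex n k) => j _; rewrite ?mxtens_indexK ?mxtens_unindexK.
rewrite (eq_bigr (fun s => G (mxtens_unindex i).1 s.1 : nat)) => [|s _].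
  rewrite -(pair_bigA _ (fun x _ => G (mxtens_unindex i).1 x : nat)) /=.
  by apply: eq_bigr => x _; rewrite sum_nat_const card_ord mulnC.
by rewrite /= /blowup_edge mxtens_indexK.
Qed.

Lemma degmx_blowup (C : numClosedFieldType) :
  degmx C blowup_digraph = tensmx (degmx C G) (k%:R *: 1%:M).
Proof.
apply/matrixP=> i j; case: (mxtens_indexP i) (mxtens_indexP j) => x a [y b].
rewrite tensmxE !mxE outdeg_blowup mxtens_indexK /=.
rewrite (can_eq (@mxtens_indexK n k)) xpair_eqE natrM.
by case: (x == y) (a == b) => [] []; rewrite ?mulr1n ?mulr0n ?mulr1 ?mulr0 ?mul0r.
Qed.

(** The tensor product of [degmx C G] and [ones C k] is added to one term and subtracted from the
    other. *)
Lemma laplacian_blowup (C : numClosedFieldType) :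
  laplacian C blowup_digraph = blowup k (laplacian C G) (degmx C G).
Proof.
rewrite /laplacian -/(degmx C _) -/(degmx C G) adjmx_blowup degmx_blowup.
by rewrite /blowup tensmxBl tensmxBr [RHS]addrC addrA subrK.
Qed.

Lemma restricted_normal_blowup (C : numClosedFieldType) : (0 < n)%N -> (0 < k)%N ->
  restricted_normal C blowup_digraph <-> restricted_normal C G.
Proof.
move=> n_gt0 k_gt0.
have nk_gt0 : (0 < n * k)%N by rewrite muln_gt0 n_gt0.
have := restricted_normal_centering C blowup_digraph nk_gt0.
(* Before and after centering, the second component is the normal matrix [degmx C G], so both
   conditions descend to [G]. *)
rewrite laplacian_blowup centering_blowup // !blowup_normal ?degmx_normal //.
move=> hatE; apply: iff_trans hatE (iff_sym _).
exact: restricted_normal_centering.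
Qed.

Lemma directed_join_blowup : (0 < k)%N ->
  directed_join blowup_digraph <-> directed_join G.
Proof.
move=> k_gt0; pose z := Ordinal k_gt0.
split=> [[W1 [W2 [covW disW W1n0 W2n0 edgeW]]]|
         [V1 [V2 [covV disV /set0Pn[x xV] /set0Pn[y yV] edgeV]]]].
  (* Two copies of a vertex are not adjacent, so they lie on the same side. *)
  have same i j : (mxtens_unindex i).1 = (mxtens_unindex j).1 ->
      (i \in W1) = (j \in W1).
    have side s t : (mxtens_unindex s).1 = (mxtens_unindex t).1 ->
        s \in W1 -> t \in W1.
      move=> eq_st sW; have : t \in W1 :|: W2 by rewrite covW inE.
      rewrite inE => /orP[//|tW]; have [] := edgeW _ _ sW tW.
      by rewrite /= /blowup_edge eq_st edge_irr.
    by move=> eq_ij; apply/idP/idP; apply: side.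
  have W2E i : (i \in W2) = (i \notin W1).
    have /setP/(_ i) := covW; rewrite !inE.
    by have := disjoint_setI0 disW => /setP/(_ i); rewrite !inE; case: (i \in W1).
  (* By [same], the copy numbered [z] decides the side of its vertex. *)
  pose copy x : 'I_(n * k) := mxtens_index (x, z).
  have copyE i : ((copy (mxtens_unindex i).1) \in W1) = (i \in W1).
    by apply: same; rewrite mxtens_indexK.
  exists [set x | copy x \in W1], [set x | copy x \notin W1]; split.
  - by apply/setP=> x; rewrite !inE orbN.
  - by rewrite -setI_eq0; apply/eqP/setP=> x; rewrite !inE andbN.
  - by case/set0Pn: W1n0 => i iW; apply/set0Pn; exists (mxtens_unindex i).1;
      rewrite inE copyE.
  - by case/set0Pn: W2n0 => i iW; apply/set0Pn; exists (mxtens_unindex i).1;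
      rewrite inE copyE -W2E.
  - move=> x y; rewrite !inE -W2E => xW yW.
    by have := edgeW _ _ xW yW; rewrite /= /blowup_edge !mxtens_indexK.
(* Conversely, a partition of the vertices of [G] pulls back to the copies. *)
exists [set i | (mxtens_unindex i).1 \in V1], [set i | (mxtens_unindex i).1 \in V2].
split.
- by apply/setP=> i; have /setP/(_ (mxtens_unindex i).1) := covV; rewrite !inE.
- rewrite -setI_eq0; apply/eqP/setP=> i.
  by have /setP/(_ (mxtens_unindex i).1) := disjoint_setI0 disV; rewrite !inE.
- by apply/set0Pn; exists (mxtens_index (x, z)); rewrite inE mxtens_indexK.
- by apply/set0Pn; exists (mxtens_index (y, z)); rewrite inE mxtens_indexK.
- by move=> i j; rewrite !inE; apply: edgeV.
Qed.

End BlowupDigraph.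

Theorem theorem3p13 (C : numClosedFieldType) (n : nat) (G : digraph n)
    (hG : restricted_normal C G) (k : nat) (hk : (1 <= k)%N) :
  exists Ghat : digraph (n * k),
    [/\ adjmx C Ghat = tensmx (adjmx C G) (ones C k),
        restricted_normal C Ghat &
        directed_join Ghat <-> directed_join G].
Proof.
have n_gt0 : (0 < n)%N.
  (* In order 0 the Laplacian is the empty matrix, which is normal, against [hG]. *)
  case: n G hG => // G [] /normalmxP[].
  by rewrite [LHS]flatmx0 [RHS]flatmx0.
exists (blowup_digraph k G); split.
- exact: adjmx_blowup.
- exact/restricted_normal_blowup.
- exact: directed_join_blowup.
Qed.
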